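(* Let $G$ be a finite group that is a central product of its subgroups $A$ and $B$. Then the height of $\mathcal{CD}(G)$ is equal to the sum of the heights of $\mathcal{CD}(A)$ and $\mathcal{CD}(B)$. Moreover, if $HK \in \mathcal{CD}(G)$ with $A\cap B \leq H \leq A$ and $A\cap B\leq K \leq B$, then $H \in \mathcal{CD}(A)$, $K\in\mathcal{CD}(B)$, the height of $HK$ in $\mathcal{CD}(G)$ equals the sum of the height of $H$ in $\mathcal{CD}(A)$ and the height of $K$ in $\mathcal{CD}(B)$, and the depth of $HK$ in $\mathcal{CD}(G)$ equals the sum of the depth of $H$ in $\mathcal{CD}(A)$ and the depth of $K$ in $\mathcal{CD}(B)$.
   Context: A group $G$ is a central product of its subgroups $A$ and $B$ if $G = AB$ and $[A,B]=1$ (i.e. $ab=ba$ for all $a\in A$, $b\in B$). For a finite group $G$ and $H \leq G$, the Chermak--Delgado measure is $m_G(H) = |H|\cdot|\mathbf{C}_G(H)|$; $m^*(G)$ denotes the maximum of $m_G(H)$ over all subgroups $H \leq G$; and the Chermak--Delgado lattice is $\mathcal{CD}(G) = \{H \leq G : m_G(H) = m^*(G)\}$. It is a modular sublattice of the subgroup lattice of $G$, with top element $T_G$ and bottom element $B_G$. The lattices $\mathcal{CD}(A)$, $\mathcal{CD}(B)$ are defined with $A$, $B$ as ambient groups. The depth of $H \in \mathcal{CD}(G)$ is the length $n$ of a maximal chain $H = G_0 < G_1 < \dots < G_n = T_G$ of elements of $\mathcal{CD}(G)$; the height of $H\in\mathcal{CD}(G)$ is the length $n$ of a maximal chain $B_G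 = G_0 < G_1 < \dots < G_n = H$ of elements of $\mathcal{CD}(G)$. These are well defined because $\mathcal{CD}(G)$ is modular. The height of $\mathcal{CD}(G)$ is the height of its top element. *)

(* Defs.v *)
From mathcomp Require Import all_boot all_fingroup.

Set Implicit Arguments.
Unset Strict Implicit.
Unset Printing Implicit Defensive.

Local Open Scope group_scope.

Section ChermakDelgado.

Variable gT : finGroupType.
Implicit Types (G H K X Y : {group gT}) (C : {set {group gT}}).

Definition cd_measure G H : nat := (#|H| * #|'C_G(H)|)%N.

Definition cd_max G : nat := \max_(H in subgroups G) cd_measure G H.

Definition CD G : {set {group gT}} :=
  [set H in subgroups G | cd_measure G H == cd_max G].

(* The top and bottom of the lattice are the join and the meet of all its     *)
(* members; cd_topP and cd_botP check that these are its greatest and least   *)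
(* elements.                                                                  *)
Definition cd_top G : {group gT} := (\prod_(H in CD G) H)%G.

Definition cd_bot G : {group gT} := [group of \bigcap_(H in CD G) H].

(* C is the set of terms of a chain H = G_0 < ... < G_n = K of elements of    *)
(* CD G, so n is #|C|.-1.                                                     *)
Definition cd_chain G H K C : bool :=
  [&& C \subset CD G, H \in C, K \in C,
      [forall X in C, (H \subset X) && (X \subset K)]
    & [forall X in C, forall Y in C, (X \subset Y) || (Y \subset X)]].

(* The length of some maximal chain of CD G from H to K; as CD G is a modular *)
(* lattice, it does not depend on the chain picked. The value 0 in the        *)
(* default case is junk; for H, K in CD G it occurs only if ~~ (H \subset K). *)
Definition cd_length G H K : nat :=
  if [pick C : {set {group gT}} | maxset (cd_chain G H K) C] is Some C
  then #|C|.-1 else 0.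

Definition cd_height G H : nat := cd_length G (cd_bot G) H.

Definition cd_depth G H : nat := cd_length G H (cd_top G).

Definition cd_lattice_height G : nat := cd_height G (cd_top G).

Lemma cd_measure_le G H : H \subset G -> (cd_measure G H <= cd_max G)%N.
Proof.
move=> sHG; rewrite /cd_max.
by apply: (@leq_bigmax_cond _ (fun H => H \in subgroups G)); rewrite inE.
Qed.

Lemma cd_measure_gt0 G H : (0 < cd_measure G H)%N.
Proof. by rewrite muln_gt0 !cardG_gt0. Qed.

Lemma CD_neq0 G : exists H, H \in CD G.
Proof.
have G_in : G \in subgroups G by rewrite inE.
have [|H sHG maxH] := @eq_bigmax_cond _ (mem (subgroups G)) (cd_measure G).
  by apply/card_gt0P; exists G.
by exists H; rewrite inE sHG /cd_max maxH /=.
Qed.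

Lemma cd_measure_submod G H K :
  (cd_measure G H * cd_measure G K <=
   cd_measure G (H <*> K)%G * cd_measure G (H :&: K)%G)%N.
Proof.
rewrite /cd_measure /= mulnACA [X in (_ <= X)%N]mulnACA leq_mul //.
  rewrite mul_cardG leq_mul2r subset_leq_card ?orbT //.
  by rewrite mulG_subG joing_subl joing_subr.
rewrite mul_cardG mulnC leq_mul ?subset_leq_card //.
  by rewrite centY setIACA setIid.
by rewrite mulG_subG !setIS ?centS ?subsetIl ?subsetIr.
Qed.

Lemma CD_lattice G H K : H \in CD G -> K \in CD G ->
  (H <*> K)%G \in CD G /\ (H :&: K)%G \in CD G.
Proof.
rewrite !inE => /andP[sHG /eqP mH] /andP[sKG /eqP mK].
have sYG : H <*> K \subset G by rewrite join_subG sHG.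
have sIG : H :&: K \subset G by rewrite subIset ?sHG.
have := cd_measure_submod G H K; rewrite mH mK => le_m.
have leY := @cd_measure_le G (H <*> K)%G sYG.
have leI := @cd_measure_le G (H :&: K)%G sIG.
have m_gt0 : (0 < cd_max G)%N by rewrite -mH cd_measure_gt0.
rewrite sYG sIG !eqn_leq leY leI /=; split.
  rewrite -(leq_pmul2r m_gt0); apply: leq_trans le_m _.
  by rewrite leq_mul2l leI orbT.
rewrite -(leq_pmul2l m_gt0); apply: leq_trans le_m _.
by rewrite leq_mul2r leY orbT.
Qed.

Lemma cd_topP G :
  cd_top G \in CD G /\ {in CD G, forall H, H \subset cd_top G}.
Proof.
have top_ub : {in CD G, forall H, H \subset cd_top G}.
  by move=> H CDH; rewrite /cd_top (bigD1 H) //= joing_subl.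
split=> //; have [H0 CD0] := CD_neq0 G.
suffices: (H0 <*> cd_top G)%G \in CD G.
  rewrite (_ : (H0 <*> _)%G = cd_top G) //; apply/val_inj/eqP.
  by rewrite eqEsubset join_subG top_ub //= subxx joing_subr.
apply: (big_rec (fun X : {group gT} => (H0 <*> X)%G \in CD G)) => [|H X CDH].
  by rewrite (_ : (H0 <*> 1)%G = H0) //; apply/val_inj; rewrite /= joingG1.
case/(CD_lattice CDH) => CDHX _.
suffices ->: (H0 <*> (H <*> X))%G = (H <*> (H0 <*> X))%G by [].
by apply/val_inj; rewrite /= !joingA (joingC H).
Qed.

Lemma cd_botP G :
  cd_bot G \in CD G /\ {in CD G, forall H, cd_bot G \subset H}.
Proof.
have bot_lb : {in CD G, forall H, cd_bot G \subset H}.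
  by move=> H CDH; apply: bigcap_inf.
split=> //; have [H0 CD0] := CD_neq0 G.
have CDI (r : seq {group gT}) : {subset r <= CD G} ->
    exists2 X : {group gT}, X \in CD G & X :=: H0 :&: \bigcap_(H <- r) H.
  elim: r => [_ | H r IHr sr]; first by exists H0; rewrite ?big_nil ?setIT.
  have [|X CDX defX] := IHr; first by move=> K rK; rewrite sr ?inE ?rK ?orbT.
  have [_ CDHX] := CD_lattice (sr H (mem_head _ _)) CDX.
  by exists (H :&: X)%G; rewrite // big_cons /= defX setICA.
have [|X CDX defX] := CDI (enum (CD G)); first by move=> H; rewrite mem_enum.
suffices ->: cd_bot G = X by [].
apply/val_inj; rewrite /= defX big_enum /=; apply/esym/setIidPr.
exact: bot_lb.
Qed.

End ChermakDelgado.

(* Main.v *)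
Require Import Defs.
From mathcomp Require Import all_boot all_fingroup.

Local Open Scope group_scope.

(** Write Z = A :&: B and let m denote the Chermak-Delgado measure.

    Two inequalities relate the measures of the three groups.  If H <= A and
    K <= B then H :&: K <= Z, and C_A(H) C_B(K) centralises HK, whence
      m_A(H) m_B(K) <= m_G(HK) |Z|^2        (cprod_measure_le_join).
    Conversely, let X <= G.  Modulo A the group X becomes XA :&: B modulo Z, so
    |X| |Z| = |X :&: A| |XA :&: B|; the same count for C_G(X), with A and B
    exchanged, gives
      m_G(X) |Z|^2 <= m_A(X :&: A) m_B(XA :&: B)    (cprod_measure_le_proj).
    Hence m*(G) |Z|^2 = m*(A) m*(B), the product HK is in CD(G) whenever H is
    in CD(A) and K in CD(B), and for X in CD(G) both X :&: A and XA :&: B are in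
    the lattices of the factors.  In general CD(G) has members that are not of
    the form HK, but its bottom and its top are the products of the bottoms
    and of the tops.

    The lengths are compared along saturated chains.  The equality case of
    submodularity says that two members of CD(G) permute (CD_permutes), so
    Dedekind's law makes CD(G) semimodular, and all its saturated chains with
    the same ends have the same length (cd_saturated_size).  Finally, for K in
    CD(B), the map H |-> HK carries coverings of CD(A) to coverings of CD(G):
    a member X of CD(G) between HK and H'K equals (X :&: A) K by Dedekind's law,
    and X :&: A is a member of CD(A) between H and H' (cd_cover_joinl).  Going
    from HK to H'K and then to H'K' thus concatenates the images of a saturated
    chain of CD(A) and of one of CD(B). *)

(** * Coverings and saturated chains in the lattice of one group *)

Section Saturated.

Context {gT : finGroupType}.
Implicit Types (G H K X Y W : {group gT}) (C : {set {group gT}}).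
Implicit Types s t : seq {group gT}.

Definition cd_cover G X Y : bool :=
  [&& X \in CD G, Y \in CD G, X \proper Y
    & [forall W in CD G, (X \subset W) && (W \subset Y) ==>
                         (W == X) || (W == Y)]].

Lemma CD_sub {G H} : H \in CD G -> H \subset G.
Proof. by rewrite !inE => /andP[]. Qed.

Lemma CD_measure {G H} : H \in CD G -> cd_measure G H = cd_max G.
Proof. by rewrite inE => /andP[_ /eqP]. Qed.

Lemma CD_intro {G H} :
  H \subset G -> (cd_max G <= cd_measure G H)%N -> H \in CD G.
Proof. by move=> sHG le; rewrite !inE sHG eqn_leq cd_measure_le. Qed.

Lemma cd_coverP {G X Y} :
  reflect [/\ X \in CD G, Y \in CD G, X \proper Y
            & forall W, W \in CD G -> X \subset W -> W \subset Y ->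
                        W = X \/ W = Y]
          (cd_cover G X Y).
Proof.
apply: (iffP and4P) => [[CDX CDY prXY /forall_inP cov]|[CDX CDY prXY cov]].
  split=> // W CDW sXW sWY; have := cov W CDW; rewrite sXW sWY /=.
  by case/orP=> /eqP; [left | right].
split=> //; apply/forall_inP=> W CDW; apply/implyP=> /andP[sXW sWY].
by have [->|->] := cov W CDW sXW sWY; rewrite eqxx ?orbT.
Qed.

(** Multiplying H by the centre does not change its centraliser, so the measure
    grows unless the centre is already contained in H. *)
Lemma center_sub_CD {G H} : H \in CD G -> 'C_G(G) \subset H.
Proof.
move=> CDH; have sHG := CD_sub CDH.
have sYG : H <*> 'C_G(G) \subset G by rewrite join_subG sHG subsetIl.
have CY : 'C_G(H <*> 'C_G(G)) = 'C_G(H).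
  rewrite centY setIA; apply/setIidPl.
  by rewrite subIset // centsC subsetIr.
have := @cd_measure_le _ G (H <*> 'C_G(G))%G sYG; rewrite -(CD_measure CDH).
rewrite /cd_measure /= CY leq_pmul2r ?cardG_gt0 // => leYH.
have /eqP-> : H :==: H <*> 'C_G(G) by rewrite eqEcard joing_subl.
exact: joing_subr.
Qed.

(** Submodularity of the measure is a product of two inequalities, one for the
    orders and one for the centralisers; on CD(G) both must be equalities, and
    the first one compares the order of HK with that of the join. *)
Lemma CD_permutes {G H K} : H \in CD G -> K \in CD G -> H <*> K = H * K.
Proof.
move=> CDH CDK; have [CDY CDI] := CD_lattice CDH CDK.
have leC : (#|'C_G(H)| * #|'C_G(K)| <=
            #|'C_G(H <*> K)| * #|'C_G(H :&: K)|)%N.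
  rewrite mul_cardG mulnC leq_mul ?subset_leq_card //.
    by rewrite centY setIACA setIid.
  by rewrite mulG_subG !setIS ?centS ?subsetIl ?subsetIr.
have eqm : (#|H| * #|K| * (#|'C_G(H)| * #|'C_G(K)|) =
            #|H <*> K| * #|H :&: K| *
              (#|'C_G(H <*> K)| * #|'C_G(H :&: K)|))%N.
  rewrite mulnACA [RHS]mulnACA.
  rewrite -[LHS]/(cd_measure G H * cd_measure G K)%N.
  rewrite -[RHS]/(cd_measure G (H <*> K)%G * cd_measure G (H :&: K)%G)%N.
  rewrite (CD_measure CDH) (CD_measure CDK).
  by rewrite (CD_measure CDY) (CD_measure CDI).
have leY : (#|H <*> K| * #|H :&: K| <= #|H| * #|K|)%N.
  have C_gt0 : (0 < #|'C_G(H)| * #|'C_G(K)|)%N by rewrite muln_gt0 !cardG_gt0.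
  by rewrite -(leq_pmul2r C_gt0) eqm leq_mul2l leC orbT.
apply/esym/eqP; rewrite eqEcard mulG_subG joing_subl joing_subr /=.
by rewrite -(leq_pmul2r (cardG_gt0 (H :&: K)%G)) -mul_cardG.
Qed.

(** Let V be a member of CD(G) with Y <= V <= YW.  As YW is the join, Dedekind's
    law gives V = Y (V :&: W), and V :&: W lies between X and W, which leaves
    only V = Y and V = YW. *)
Lemma cd_cover_semimodular {G X Y W} :
  cd_cover G X Y -> cd_cover G X W -> Y != W -> cd_cover G Y (Y <*> W)%G.
Proof.
case/cd_coverP=> CDX CDY prXY covY /cd_coverP[_ CDW prXW covW] neqYW.
have [CDJ CDI] := CD_lattice CDY CDW.
have [sXY sXW] := (proper_sub prXY, proper_sub prXW).
apply/cd_coverP; split=> // [|V CDV sYV sVJ].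
  rewrite /proper joing_subl join_subG subxx /=; apply: contra neqYW => sWY.
  case: (covY W CDW sXW sWY) => eqW; last by rewrite eqW.
  by rewrite eqW properxx in prXW.
have defV : V :=: Y * (V :&: W).
  by rewrite setIC group_modl // -(CD_permutes CDY CDW) (setIidPr sVJ).
have [_ CDVW] := CD_lattice CDV CDW.
have [|| eqVW | eqVW] := covW _ CDVW.
- by rewrite subsetI sXW (subset_trans sXY).
- exact: subsetIr.
- left; apply/val_inj; rewrite /= defV -[_ :&: _]/(gval (V :&: W)%G) eqVW.
  by rewrite mulGSid.
right; apply/val_inj; rewrite /= defV -[V :&: W]/(gval (V :&: W)%G) eqVW.
exact/esym/(CD_permutes CDY CDW).
Qed.

Lemma cd_path_sub {G X s} : path (cd_cover G) X s -> X \subset last X s.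
Proof.
elim: s X => //= Y s IHs X /andP[/cd_coverP[_ _ prXY _] /IHs].
exact: subset_trans (proper_sub prXY).
Qed.

Lemma cd_path_CD {G X s} :
  X \in CD G -> path (cd_cover G) X s -> last X s \in CD G.
Proof.
by elim: s X => //= Y s IHs X _ /andP[/cd_coverP[_ CDY _ _] /IHs]; apply.
Qed.

Lemma cd_chainP {G X Y C} :
  reflect [/\ {subset C <= CD G}, X \in C, Y \in C,
              {in C, forall W : {group gT}, X \subset W /\ W \subset Y}
            & {in C &, forall V W : {group gT}, V \subset W \/ W \subset V}]
          (cd_chain G X Y C).
Proof.
apply: (iffP and5P) => [] [sC CX CY bC tC]; split=> //; try exact/subsetP.
- by move=> W CW; apply/andP; apply: (forall_inP bC).
- by move=> V W CV CW; apply/orP; apply: (forall_inP (forall_inP tC V CV)).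
- by apply/forall_inP=> W /bC[-> ->].
by apply/forall_inP=> V CV; apply/forall_inP=> W CW; apply/orP/tC.
Qed.

(** Listed in increasing order, a maximal chain is saturated: a member of the
    lattice strictly between two consecutive terms could be added to it. *)
Lemma maxset_cd_chain_path {G X Y C} :
  maxset (cd_chain G X Y) C ->
  exists2 s, path (cd_cover G) X s & last X s = Y /\ #|C|.-1 = size s.
Proof.
case/maxsetP=> /cd_chainP[sC CX CY bC tC] maxC.
pose le := [rel V W : {group gT} | V \subset W].
have le_tr : transitive le by move=> ? ? ?; apply: subset_trans.
set r := sort le (enum C).
have mem_r : r =i C by move=> V; rewrite mem_sort mem_enum.
have uniq_r : uniq r by rewrite sort_uniq enum_uniq.
have size_r : size r = #|C| by rewrite size_sort cardE.
have le_r : sorted le r.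
  apply: (@sort_sorted_in _ (mem C)) => [V W CV CW|].
    by apply/orP; apply: tC.
  by apply/allP=> V; rewrite mem_enum.
have le_nth i j : i <= j -> j < size r -> nth X r i \subset nth X r j.
  move=> leij ltj; apply: (sorted_leq_nth le_tr (fun=> subxx _) X le_r) => //.
  by rewrite inE (leq_ltn_trans leij).
have nthC i : i < size r -> nth X r i \in C by rewrite -mem_r; apply: mem_nth.
have cov_r i : i.+1 < size r -> cd_cover G (nth X r i) (nth X r i.+1).
  move=> lti; have lti' := ltnW lti.
  apply/cd_coverP; split; try by apply/sC/nthC.
    rewrite properEneq le_nth // andbT; apply/eqP => /val_inj/eqP.
    by rewrite nth_uniq // ltn_eqF.
  move=> W CDW sVW sWV.
  have cmpW V : V \in C -> V \subset W \/ W \subset V.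
    rewrite -mem_r => /(nthP X)[j ltj <-].
    case: (leqP j i) => [leji|ltij]; [left | right].
      by apply: subset_trans sVW; apply: le_nth.
    by apply: subset_trans sWV _; apply: le_nth.
  have CW : W \in C.
    rewrite -(maxC (W |: C)) ?setU11 ?subsetUr //.
    apply/cd_chainP; split; rewrite ?inE ?CX ?CY ?orbT //.
    - by move=> V /setU1P[->|/sC].
    - move=> V /setU1P[->|/bC//].
      split; first by apply: subset_trans sVW; case: (bC _ (nthC _ lti')).
      by apply: (subset_trans sWV); case: (bC _ (nthC _ lti)).
    move=> V1 V2 /setU1P[->|CV1] /setU1P[->|CV2]; first by left.
    - by case: (cmpW _ CV2); [right | left].
    - exact: cmpW.
    exact: tC.
  move: CW; rewrite -mem_r => /(nthP X)[j ltj defW].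
  case: (leqP j i) => [leji|ltij]; [left | right]; apply/val_inj/eqP;
    rewrite eqEsubset /= ?sVW ?sWV ?andbT /=.
    by rewrite -defW le_nth.
  by rewrite -defW le_nth.
have r_gt0 : 0 < size r by rewrite size_r; apply/card_gt0P; exists X.
have r0 : nth X r 0 = X.
  move: CX; rewrite -mem_r => /(nthP X)[j ltj defX].
  apply/val_inj/eqP; rewrite eqEsubset; apply/andP; split.
    by have := le_nth 0 j (leq0n j) ltj; rewrite defX.
  by case: (bC _ (nthC 0 r_gt0)).
have rlast : last X r = Y.
  rewrite -nth_last; have lt_last : (size r).-1 < size r by rewrite prednK.
  move: CY; rewrite -mem_r => /(nthP X)[j ltj defY].
  apply/val_inj/eqP; rewrite eqEsubset; apply/andP; split.
    by case: (bC _ (nthC _ lt_last)).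
  by rewrite -defY le_nth // -ltnS prednK.
case: r r0 rlast size_r cov_r {le_r le_nth nthC mem_r uniq_r r_gt0} => //=.
  by move=> _ _ C0 _; move: CX; rewrite (cards0_eq (esym C0)) inE.
move=> V s -> sY <- cov_r; exists s; last by [].
by apply/(pathP X) => i lti; apply: (cov_r i).
Qed.

Lemma cd_length_path {G X Y} : X \in CD G -> Y \in CD G -> X \subset Y ->
  exists2 s, path (cd_cover G) X s & last X s = Y /\ cd_length G X Y = size s.
Proof.
move=> CDX CDY sXY; rewrite /cd_length.
case: pickP => [C /maxset_cd_chain_path //| noC].
have chXY : cd_chain G X Y [set X; Y].
  apply/cd_chainP; split; rewrite ?set21 ?set22 //.
  - by move=> W /set2P[]->.
  - by move=> W /set2P[]->.
  by move=> V W /set2P[]-> /set2P[]->; rewrite ?subxx ?sXY; auto.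
by have [C maxC _] := maxset_exists chXY; have := noC C; rewrite maxC.
Qed.

(** The Jordan-Dedekind chain condition.  If two saturated chains from X start
    with different steps Y and W, both are compared with a saturated chain that
    goes through the join of Y and W. *)
Lemma cd_saturated_size {G X s t} :
    path (cd_cover G) X s -> path (cd_cover G) X t ->
  last X s = last X t -> size s = size t.
Proof.
have [n] := ubnP (size s); elim: n => // n IHn in X s t *.
case: s t => [|Y s] [|W t] //=.
- move=> _ _ /andP[/cd_coverP[_ _ prXW _] /cd_path_sub sW eqX].
  by case/idPn: prXW; rewrite eqX /proper sW andbF.
- move=> _ /andP[/cd_coverP[_ _ prXY _] /cd_path_sub sY] _ eqX.
  by case/idPn: prXY; rewrite -eqX /proper sY andbF.
rewrite ltnS => lts /andP[covY pathY] /andP[covW pathW] eqlast.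
have [eqYW | neqYW] := eqVneq Y W.
  by rewrite -eqYW in pathW eqlast; congr _.+1; apply: IHn eqlast.
have [[_ CDY _ _] [_ CDW _ _]] := (cd_coverP covY, cd_coverP covW).
have covYJ := cd_cover_semimodular covY covW neqYW.
have covWJ : cd_cover G W (Y <*> W)%G.
  rewrite (_ : (Y <*> W)%G = (W <*> Y)%G).
    by apply: cd_cover_semimodular covW covY _; rewrite eq_sym.
  by apply/val_inj; rewrite /= joingC.
have [CDJ _] := CD_lattice CDY CDW.
have sJ : (Y <*> W)%G \subset last Y s.
  by rewrite join_subG (cd_path_sub pathY) eqlast (cd_path_sub pathW).
have [u pathu [lastu _]] := cd_length_path CDJ (cd_path_CD CDY pathY) sJ.
have size_s : size s = (size u).+1.
  by apply: (IHn Y s ((Y <*> W)%G :: u)); rewrite //= ?covYJ ?lastu.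
rewrite size_s; congr _.+1.
apply: (IHn W ((Y <*> W)%G :: u) t); rewrite //= ?covWJ ?lastu //.
by rewrite -size_s.
Qed.

Lemma cd_length_saturated {G X s} :
  X \in CD G -> path (cd_cover G) X s -> cd_length G X (last X s) = size s.
Proof.
move=> CDX pathXs; have CDY := cd_path_CD CDX pathXs.
have [t patht [lastt ->]] := cd_length_path CDX CDY (cd_path_sub pathXs).
exact: cd_saturated_size patht pathXs lastt.
Qed.

End Saturated.

(** * The measure of a central product *)

Section Measure.

Context {gT : finGroupType} {G A B : {group gT}}.
Hypothesis defG : A \* B = G.
Implicit Types (H K X : {group gT}).

Let cAB : A \subset 'C(B).
Proof. by have [] := cprodP defG; rewrite // centsC. Qed.

Let mulAB : A * B = G.
Proof. by have [] := cprodP defG. Qed.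

Let sAG : A \subset G. Proof. by rewrite -mulAB mulG_subl. Qed.
Let sBG : B \subset G. Proof. by rewrite -mulAB mulG_subr. Qed.

Lemma cprod_join_mul {H K} : H \subset A -> K \subset B -> H <*> K = H * K.
Proof.
move=> sHA sKB; apply: cent_joinEr.
by rewrite (subset_trans sKB) // centsC (subset_trans sHA).
Qed.

Lemma cprod_join_sub {H K} : H \subset A -> K \subset B -> H <*> K \subset G.
Proof.
by move=> sHA sKB; rewrite join_subG (subset_trans sHA) ?(subset_trans sKB).
Qed.

(** Since H :&: K is contained in Z = A :&: B, the product |H| |K| is at
    most |HK| |Z|; the second factor |Z| comes from the same bound for
    C_A(H) C_B(K), which is contained in C_G(HK). *)
Lemma cprod_measure_le_join {H K} : H \subset A -> K \subset B ->
  (cd_measure A H * cd_measure B K <=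
   cd_measure G (H <*> K)%G * (#|A :&: B| * #|A :&: B|))%N.
Proof.
move=> sHA sKB.
have le_mul (H1 K1 : {group gT}) : H1 \subset A -> K1 \subset B ->
    (#|H1| * #|K1| <= #|(H1 * K1)%g| * #|A :&: B|)%N.
  by move=> sH1 sK1; rewrite mul_cardG leq_mul2l subset_leq_card ?setISS ?orbT.
rewrite /cd_measure mulnACA [X in (_ <= X)%N]mulnACA leq_mul //.
  by rewrite /= cprod_join_mul ?le_mul.
apply: leq_trans (le_mul _ _ (subsetIl _ _) (subsetIl _ _)) _.
rewrite leq_mul2r subset_leq_card ?orbT //= centY mulG_subG !subsetI.
rewrite !subsetIr ![_ :&: _ \subset G]subIset ?sAG ?sBG //= ?andbT.
apply/andP; split; apply: subset_trans (subsetIl _ _) _.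
  by rewrite (subset_trans cAB) ?centS.
by apply: subset_trans (centS sHA); rewrite centsC.
Qed.

Lemma cprod_mul_proj {X} : X \subset G -> A * (X <*> A :&: B) = X <*> A.
Proof.
move=> sXG; rewrite setIC group_modl ?joing_subr // mulAB.
by apply/setIidPr; rewrite join_subG sXG.
Qed.

(** Modulo A, the group X becomes XA / A, which is isomorphic to
    (XA :&: B) / (A :&: B). *)
Lemma cprod_card_proj {X} :
  X \subset G -> (#|X| * #|A :&: B| = #|X :&: A| * #|X <*> A :&: B|)%N.
Proof.
move=> sXG; have [nsAG _] := cprod_normal2 defG.
have defXA : X <*> A = X * A.
  by apply: norm_joinEl; apply: subset_trans sXG (normal_norm nsAG).
have defZ : A :&: (X <*> A :&: B) = A :&: B.
  by rewrite setIA (setIidPl (joing_subr X A)).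
have eqA := mul_cardG A (X <*> A :&: B)%G.
rewrite /= (cprod_mul_proj sXG) defZ defXA in eqA.
apply/eqP; rewrite -(eqn_pmul2l (cardG_gt0 A)); apply/eqP.
rewrite [RHS]mulnCA defXA eqA mulnA (mulnC #|A|) mul_cardG.
by rewrite mulnA (mulnC #|X :&: A|).
Qed.

(** With cprod_cap_sub_CD below, this recovers the factors of a product of
    members of CD(A) and CD(B). *)
Lemma cprod_join_capl {H K} : A :&: B \subset H -> H \subset A -> K \subset B ->
  (H <*> K) :&: A = H.
Proof.
move=> sZH sHA sKB; rewrite cprod_join_mul // -group_modl // mulGSid //.
by apply: subset_trans sZH; rewrite /= setIC setIS.
Qed.

(** The intersection of A and B is central in A. *)
Lemma cprod_cap_sub_CD {H} : H \in CD A -> A :&: B \subset H.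
Proof.
move/center_sub_CD; apply: subset_trans.
by rewrite subsetI subsetIl subIset // orbC centsC cAB.
Qed.

End Measure.

Section Lattice.

Context {gT : finGroupType} {G A B : {group gT}}.
Hypothesis defG : A \* B = G.
Implicit Types (H K X : {group gT}).

Let defGr : B \* A = G. Proof. by rewrite cprodC. Qed.
Let cBA : B \subset 'C(A). Proof. by have [] := cprodP defG. Qed.

(** Both |X| and |C_G(X)| are split by cprod_card_proj, the second one with A
    and B exchanged.  The factor C_G(X) :&: B of the latter centralises
    XA :&: B, because B centralises A; its factor C_G(X) B :&: A centralises
    X :&: A, because B does. *)
Lemma cprod_measure_le_proj {X} : X \subset G ->
  (cd_measure G X * (#|A :&: B| * #|A :&: B|) <=
   cd_measure A (X :&: A)%G * cd_measure B (X <*> A :&: B)%G)%N.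
Proof.
move=> sXG; have eqX := cprod_card_proj defG sXG.
have := cprod_card_proj defGr (subsetIl G 'C(X)); rewrite (setIC B) => eqC.
rewrite /cd_measure mulnACA eqX eqC [X in (_ * X)%N]mulnC mulnACA /=.
have sCA : 'C_G(X) <*> B :&: A \subset 'C_A(X :&: A).
  rewrite subsetI subsetIr subIset // join_subG; apply/orP; left.
  rewrite (subset_trans (subsetIr _ _)) ?centS ?subsetIl //=.
  by rewrite (subset_trans cBA) // centS ?subsetIr.
have sCB : 'C_G(X) :&: B \subset 'C_B(X <*> A :&: B).
  rewrite subsetI subsetIr (subset_trans _ (centS (subsetIl _ _))) //= centY.
  exact: setISS (subsetIr _ _) cBA.
by rewrite !leq_mul ?subset_leq_card.
Qed.

Lemma cprod_cd_max :
  (cd_max G * (#|A :&: B| * #|A :&: B|) = cd_max A * cd_max B)%N.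
Proof.
have [[[X CDX] [H CDH]] [K CDK]] := (CD_neq0 G, CD_neq0 A, CD_neq0 B).
apply/eqP; rewrite eqn_leq; apply/andP; split.
  rewrite -(CD_measure CDX).
  apply: leq_trans (cprod_measure_le_proj (CD_sub CDX)) _.
  by rewrite leq_mul // cd_measure_le ?subsetIr.
rewrite -(CD_measure CDH) -(CD_measure CDK).
apply: leq_trans (cprod_measure_le_join defG (CD_sub CDH) (CD_sub CDK)) _.
rewrite leq_mul2r cd_measure_le ?orbT //=.
exact (cprod_join_sub defG (CD_sub CDH) (CD_sub CDK)).
Qed.

Lemma CD_cprod_join {H K} : H \in CD A -> K \in CD B -> (H <*> K)%G \in CD G.
Proof.
move=> CDH CDK; have [sHA sKB] := (CD_sub CDH, CD_sub CDK).
apply: CD_intro; first exact: (cprod_join_sub defG).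
have z2_gt0 : (0 < #|A :&: B| * #|A :&: B|)%N by rewrite muln_gt0 cardG_gt0.
rewrite -(leq_pmul2r z2_gt0) cprod_cd_max -(CD_measure CDH) -(CD_measure CDK).
exact: cprod_measure_le_join.
Qed.

(** For X in CD(G) the bound of cprod_measure_le_proj is attained, by
    cprod_cd_max, so both of its factors are maximal. *)
Lemma CD_cprod_proj {X} :
  X \in CD G -> (X :&: A)%G \in CD A /\ (X <*> A :&: B)%G \in CD B.
Proof.
move=> CDX; have := cprod_measure_le_proj (CD_sub CDX).
rewrite (CD_measure CDX) cprod_cd_max => le_m.
have leA := @cd_measure_le _ A (X :&: A)%G (subsetIr _ _).
have leB := @cd_measure_le _ B (X <*> A :&: B)%G (subsetIr _ _).
have [H CDH] := CD_neq0 A; have [K CDK] := CD_neq0 B.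
have mA_gt0 : (0 < cd_max A)%N by rewrite -(CD_measure CDH) cd_measure_gt0.
have mB_gt0 : (0 < cd_max B)%N by rewrite -(CD_measure CDK) cd_measure_gt0.
split; apply: CD_intro; rewrite ?subsetIr //.
  by rewrite -(leq_pmul2r mB_gt0) (leq_trans le_m) // leq_mul2l leB orbT.
by rewrite -(leq_pmul2l mA_gt0) (leq_trans le_m) // leq_mul2r leA orbT.
Qed.

(** Coverings are preserved because, by Dedekind's law, any X in CD(G) between
    HK and H'K is the product of X :&: A and K. *)
Lemma cd_cover_joinl {H H' K} : K \in CD B -> cd_cover A H H' ->
  cd_cover G (H <*> K)%G (H' <*> K)%G.
Proof.
move=> CDK /cd_coverP[CDH CDH' prHH' covH].
have [[sHA sH'A] sKB] := (CD_sub CDH, CD_sub CDH', CD_sub CDK).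
have capl V : V \in CD A -> (V <*> K) :&: A = V.
  move=> CDV; apply: (cprod_join_capl defG) (CD_sub CDV) sKB.
  exact: (cprod_cap_sub_CD defG).
have sHH' := proper_sub prHH'.
apply/cd_coverP; split; try exact: CD_cprod_join.
  rewrite properEneq genS ?setSU // andbT; apply: contraTneq prHH' => eqHK.
  by rewrite -(capl H CDH) eqHK capl // properxx.
move=> X CDX sHKX sXH'K; have [CDXA _] := CD_cprod_proj CDX.
have [sHX sKX] : H \subset X /\ K \subset X.
  by move: sHKX; rewrite join_subG => /andP[].
have defX : X = ((X :&: A)%G <*> K)%G.
  apply/val_inj; rewrite /= (cprod_join_mul defG) ?subsetIr //= group_modr //.
  apply/esym/setIidPl; apply: subset_trans sXH'K _.
  by rewrite /= (cprod_join_mul defG) // mulSg.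
have [|| <- | <-] := covH _ CDXA; try by [left | right | rewrite subsetI sHX].
by rewrite -(capl H' CDH') setSI.
Qed.

End Lattice.

(** * Lengths in a central product *)

Section Length.

Context {gT : finGroupType} {G A B : {group gT}}.
Hypothesis defG : A \* B = G.
Implicit Types (H K X : {group gT}).

Let defGr : B \* A = G. Proof. by rewrite cprodC. Qed.

Lemma cd_cover_joinr {H K K'} : H \in CD A -> cd_cover B K K' ->
  cd_cover G (H <*> K)%G (H <*> K')%G.
Proof. by rewrite ![(H <*> _)%G]joinGC; apply: cd_cover_joinl. Qed.

(** The chain climbs from HK to H'K along CD(A), then to H'K' along CD(B). *)
Lemma cd_length_cprod {H H' K K'} :
    H \in CD A -> H' \in CD A -> H \subset H' ->
    K \in CD B -> K' \in CD B -> K \subset K' ->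
  cd_length G (H <*> K)%G (H' <*> K')%G =
    (cd_length A H H' + cd_length B K K')%N.
Proof.
move=> CDH CDH' sHH' CDK CDK' sKK'.
have [s paths [lasts ->]] := cd_length_path CDH CDH' sHH'.
have [t patht [lastt ->]] := cd_length_path CDK CDK' sKK'.
pose sG := [seq (V <*> K)%G | V : {group gT} <- s].
pose tG := [seq (H' <*> V)%G | V : {group gT} <- t].
have lastsG : last (H <*> K)%G sG = (H' <*> K)%G.
  by rewrite -lasts; apply: (last_map (fun V : {group gT} => (V <*> K)%G) s H).
have lasttG : last (H' <*> K)%G tG = (H' <*> K')%G.
  by rewrite -lastt; apply: (last_map (fun V : {group gT} => (H' <*> V)%G) t K).
have pathst : path (cd_cover G) (H <*> K)%G (sG ++ tG).
  rewrite cat_path lastsG; apply/andP; split.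
    rewrite (@path_map _ _ (fun V : {group gT} => (V <*> K)%G) _ H).
    by apply: sub_path paths => V W; apply: (cd_cover_joinl defG CDK).
  rewrite (@path_map _ _ (fun V : {group gT} => (H' <*> V)%G) _ K).
  by apply: sub_path patht => V W; apply: cd_cover_joinr.
have := cd_length_saturated (CD_cprod_join defG CDH CDK) pathst.
by rewrite last_cat lastsG lasttG size_cat !size_map.
Qed.

(** The bottom of CD(G) meets A and B in members of CD(A) and CD(B). *)
Lemma cd_bot_cprod : cd_bot G = (cd_bot A <*> cd_bot B)%G.
Proof.
have [[[CDG minG] [CDA minA]] [CDB minB]] := (cd_botP G, cd_botP A, cd_botP B).
apply/val_inj/eqP; rewrite eqEsubset minG ?(CD_cprod_join defG) //= join_subG.
have [[CDGA _] [CDGB _]] := (CD_cprod_proj defG CDG, CD_cprod_proj defGr CDG).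
by rewrite (subset_trans (minA _ CDGA)) ?(subset_trans (minB _ CDGB)) ?subsetIl.
Qed.

(** Let T be the top of CD(G).  Its projection TA :&: B is contained in the top
    T_B of CD(B), so T <= A T_B; as T_B <= T, Dedekind's law gives
    T = (T :&: A) T_B, where T :&: A is a member of CD(A). *)
Lemma cd_top_cprod : cd_top G = (cd_top A <*> cd_top B)%G.
Proof.
have [[[CDG maxG] [CDA maxA]] [CDB maxB]] := (cd_topP G, cd_topP A, cd_topP B).
apply/val_inj/eqP;
  rewrite eqEsubset (maxG _ (CD_cprod_join defG CDA CDB)) andbT.
have [CDGA CDGB] := CD_cprod_proj defG CDG.
have sBT : cd_top B \subset cd_top G.
  apply: subset_trans (maxG _ (CD_cprod_join defG CDA CDB)).
  exact: joing_subr.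
have sTAB : cd_top G \subset A * cd_top B.
  apply: subset_trans (joing_subl (cd_top G) A) _.
  by rewrite -(cprod_mul_proj defG (CD_sub CDG)) mulgS // maxB.
rewrite /= -(setIidPl sTAB) -group_modr // mulG_subG joing_subr andbT.
by rewrite (subset_trans (maxA _ CDGA)) ?joing_subl.
Qed.

End Length.

(** The heights and the depths are lengths of intervals of CD(G) whose ends are
    products, so cd_length_cprod applies to all of them. *)
Theorem theorem2 (gT : finGroupType) (G A B : {group gT}) (cAB : A \* B = G) :
  cd_lattice_height G = (cd_lattice_height A + cd_lattice_height B)%N /\
  (forall H K HK : {group gT},
     A :&: B \subset H -> H \subset A ->
     A :&: B \subset K -> K \subset B ->
     HK :=: H * K -> HK \in CD G ->
     [/\ H \in CD A,
         K \in CD B,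
         cd_height G HK = (cd_height A H + cd_height B K)%N
       & cd_depth G HK = (cd_depth A H + cd_depth B K)%N]).
Proof.
have [[botA minA] [botB minB]] := (cd_botP A, cd_botP B).
have [[topA maxA] [topB maxB]] := (cd_topP A, cd_topP B).
split.
  rewrite /cd_lattice_height /cd_height (cd_bot_cprod cAB) (cd_top_cprod cAB).
  by rewrite (cd_length_cprod cAB) ?minA ?minB.
move=> H K HK sZH sHA sZK sKB defHK CDHK.
have cBA : B \* A = G by rewrite cprodC.
have eqHK : HK = (H <*> K)%G.
  by apply/val_inj; rewrite /= (cprod_join_mul cAB).
have CDH : H \in CD A.
  have [CDHKA _] := CD_cprod_proj cAB CDHK.
  suffices -> : H = (HK :&: A)%G by [].
  by apply/val_inj; rewrite eqHK /= (cprod_join_capl cAB).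
have CDK : K \in CD B.
  have [CDHKB _] := CD_cprod_proj cBA CDHK.
  suffices -> : K = (HK :&: B)%G by [].
  by apply/val_inj; rewrite eqHK /= joingC (cprod_join_capl cBA) // setIC.
split=> //; rewrite eqHK.
  by rewrite /cd_height (cd_bot_cprod cAB) (cd_length_cprod cAB) ?minA ?minB.
by rewrite /cd_depth (cd_top_cprod cAB) (cd_length_cprod cAB) ?maxA ?maxB.
Qed.
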